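(* Let $p\in[1,\infty]$, $\alpha_p>0$ and $\epsilon\ge0$. Let $\mathcal M_{TV}(\alpha_p,\epsilon)$ be the set of all randomized classifiers $\mathrm m:\mathcal X\to\mathcal P(\mathcal Y)$ that are $(\alpha_p,\epsilon)$-robust with respect to the total variation distance, and let $$\mathcal L_{\mathcal M_{TV}(\alpha_p,\epsilon)}=\{(x,y)\mapsto\mathcal L_{0/1}(\mathrm m(x),y)\mid \mathrm m\in\mathcal M_{TV}(\alpha_p,\epsilon)\}.$$ Then, for any $n\ge1$ and any sample $\mathcal S=\{(x_1,y_1),\dots,(x_n,y_n)\}$ of points of $\mathcal X\times\mathcal Y$, the empirical Rademacher complexity satisfies $$\mathfrak R_{\mathcal S}\left(\mathcal L_{\mathcal M_{TV}(\alpha_p,\epsilon)}\right)\le\sqrt{\frac{N\times K}{n}}+\epsilon,$$ where $N=N(\{x_1,\dots,x_n\},\|\cdot\|_p,\alpha_p)$ is the external $\alpha_p$-covering number of the inputs $\{x_1,\dots,x_n\}$ for the $\ell_p$ norm.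
   Context: $\mathcal X\subset[-1,1]^d$ is the input space, equipped with the $\ell_p$ norm, and $\mathcal Y=\{1,\dots,K\}$ is the label set. $\mathcal P(\mathcal Y)$ is the set of probability measures on $\mathcal Y$. A randomized classifier is a map $\mathrm m:\mathcal X\to\mathcal P(\mathcal Y)$. Total variation distance: $D_{TV}(\rho,\rho')=\sup_{Z}|\rho(Z)-\rho'(Z)|$, supremum over measurable sets $Z$. $\mathrm m$ is $(\alpha_p,\epsilon)$-robust w.r.t. $D_{TV}$ if for all $x,x'\in\mathcal X$ with $\|x-x'\|_p\le\alpha_p$ one has $D_{TV}(\mathrm m(x),\mathrm m(x'))\le\epsilon$. Loss: $\mathcal L_{0/1}(\mathrm m(x),y)=\mathbb E_{\hat y\sim \mathrm m(x)}[\mathbf 1\{\hat y\ne y\}]$. Empirical Rademacher complexity of a class $\mathcal F$ of real-valued functions of $(x,y)$: $\mathfrak R_{\mathcal S}(\mathcal F)=\frac1n\mathbb E_{r}\big[\sup_{f\in\mathcal F}\sum_{i=1}^n r_i f(x_i,y_i)\big]$, where $r_1,\dots,r_n$ are i.i.d. with $\mathbb P(r_i=1)=\mathbb P(r_i=-1)=\tfrac12$. For $B\subset\mathcal X$ and $\alpha\ge0$, a finite set $C=\{c_1,\dots,c_m\}\subset\mathcal X$ is an $\alpha$-covering of $B$ for the $\ell_p$ norm if for any $x\in B$ there is $c_i\in C$ with $\|x-c_i\|_p\le\alpha$. The external covering number $N(B,\|\cdot\|_p,\alpha)$ is the minimal cardinality of an $\alpha$-covering of $B$ (the centers need not belong to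 $B$, only to the ambient space $\mathcal X$). *)

(* Defs.v *)
From HB Require Import structures.
From mathcomp Require Import all_boot all_order all_algebra finmap.
From mathcomp Require Import all_classical all_reals all_analysis.

Set Implicit Arguments.
Unset Strict Implicit.
Unset Printing Implicit Defensive.

Import Order.TTheory GRing.Theory Num.Theory.
Import numFieldNormedType.Exports.

Local Open Scope classical_set_scope.
Local Open Scope ring_scope.

(* Probability measures require a pointed label type, so the (nonempty) label
   set is 'I_K.+1, with K.+1 labels and the discrete sigma-algebra. *)
HB.instance Definition _ (K : nat) := isPointed.Build 'I_K.+1 ord0.
HB.instance Definition _ (K : nat) :=
  @isMeasurable.Build default_measure_display 'I_K.+1
    (@discrete_measurable 'I_K.+1) (@discrete_measurable0 'I_K.+1)
    (@discrete_measurableC 'I_K.+1) (@discrete_measurableU 'I_K.+1).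

(* Only meant for 1 <= p; the last branch is p = +oo. *)
Definition lpnorm (R : realType) (d : nat) (p : \bar R) (x : 'rV[R]_d) : R :=
  if p is r%:E then (\sum_(j < d) `|x ord0 j| `^ r) `^ r^-1
  else \big[Num.max/0]_(j < d) `|x ord0 j|.

Definition cube (R : realType) (d : nat) : set 'rV[R]_d :=
  [set x | forall j, -1 <= x ord0 j <= 1].
Arguments cube : clear implicits.

Definition dTV (R : realType) (disp : measure_display)
    (T : measurableType disp) (P Q : probability T R) : \bar R :=
  ereal_sup [set `|P Z - Q Z|%E | Z in measurable].

(* A set [X] used as a type stands for its subtype of elements. *)
Definition classifier (R : realType) (d K : nat) (X : set 'rV[R]_d) : Type :=
  X -> probability 'I_K.+1 R.

Definition robust_TV (R : realType) (d K : nat) (X : set 'rV[R]_d)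
    (p : \bar R) (alpha eps : R) (m : classifier K X) : Prop :=
  forall x x' : X, lpnorm p (val x - val x') <= alpha ->
    (dTV (m x) (m x') <= eps%:E)%E.

(* The expectation lies in [0, 1], so that [fine] loses no information. *)
Definition loss01 (R : realType) (K : nat) (P : probability 'I_K.+1 R)
    (y : 'I_K.+1) : R :=
  fine ('E_P[fun yhat : 'I_K.+1 => (yhat != y)%:R])%E.

Definition loss_class (R : realType) (d K : nat) (X : set 'rV[R]_d)
    (M : set (classifier K X)) : set (X * 'I_K.+1 -> R) :=
  [set (fun z : X * 'I_K.+1 => loss01 (m z.1) z.2) | m in M].

(* Expectation of [g (r_1, ..., r_n)] for i.i.d. signs of law
   P(r_i = 1) = P(r_i = -1) = 1/2. The sign r_i is [(-1) ^+ b i] for a boolean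
   vector [b], and the joint law is the product of the marginals. *)
Definition rademacher_expectation (R : realType) (n : nat)
    (g : ('I_n -> R) -> \bar R) : \bar R :=
  (\sum_(b : {ffun 'I_n -> bool})
     (\prod_(i < n) (2^-1 : R))%:E * g (fun i => (-1) ^+ b i)%R)%E.

(* The supremum is taken in the extended reals: [F] may be empty or
   unbounded on the sample. *)
Definition rademacher_complexity (R : realType) (T : Type) (n : nat)
    (S : 'I_n -> T) (F : set (T -> R)) : \bar R :=
  ((n%:R^-1)%:E * rademacher_expectation (fun r : 'I_n -> R =>
     ereal_sup [set (\sum_(i < n) r i * f (S i))%R%:E | f in F]))%E.

Definition covering (R : realType) (d : nat) (X : set 'rV[R]_d) (p : \bar R)
    (alpha : R) (B : set 'rV[R]_d) (C : {fset 'rV[R]_d}) : Prop :=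
  [set` C] `<=` X /\
  forall x, B x -> exists2 c, c \in C & lpnorm p (x - c) <= alpha.

(* [N] is the minimal cardinality of a covering with centers in [X]; there is
   no such [N] when [B] has no finite covering, but a finite subset of [X]
   always has one, see [external_covering_number_exists]. *)
Definition is_external_covering_number (R : realType) (d : nat)
    (X : set 'rV[R]_d) (p : \bar R) (alpha : R) (B : set 'rV[R]_d)
    (N : nat) : Prop :=
  (exists2 C, covering X p alpha B C & #|` C| = N) /\
  forall C, covering X p alpha B C -> (N <= #|` C|)%N.

Lemma lpnorm0 (R : realType) (d : nat) (p : \bar R) :
  (1 <= p)%E -> lpnorm p (0 : 'rV[R]_d) = 0.
Proof.
case: p => [r||] //= => [r1|_].
- have r0 : r != 0 by rewrite gt_eqF// (lt_le_trans ltr01) // -lee_fin.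
  rewrite big1 ?powR0 ?invr_eq0// => j _.
  by rewrite mxE normr0 powR0.
- by elim/big_ind: _ => // [x y -> ->|j _]; rewrite ?maxxx ?mxE ?normr0.
Qed.

Lemma external_covering_number_exists (R : realType) (d : nat)
    (X : set 'rV[R]_d) (p : \bar R) (alpha : R) (n : nat) (x : 'I_n -> X) :
  (1 <= p)%E -> 0 <= alpha ->
  exists N, is_external_covering_number X p alpha (range (val \o x)) N.
Proof.
move=> p1 a0.
pose P N := `[< exists2 C, covering X p alpha (range (val \o x)) C
                         & #|` C| = N >].
have exP : exists N, P N.
  pose C : {fset 'rV[R]_d} := [fset (val \o x) i | i in 'I_n]%fset.
  exists #|` C|; apply/asboolP; exists C => //; split.
    by move=> _ /imfsetP[i _ ->] /=; exact: set_valP.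
  move=> _ [i _ <-]; exists (val (x i)); first by apply/imfsetP; exists i.
  by rewrite subrr lpnorm0.
exists (ex_minn exP); case: ex_minnP => N /asboolP PN minN; split=> // C covC.
by apply: minN; apply/asboolP; exists C.
Qed.

(* Main.v *)
(* Move each input to a covering center at distance at most [alpha]: by
   robustness the loss changes by at most [eps]. After that, the loss of the
   [i]-th sample point depends only on the pair (center, label), which takes
   [N * K.+1] values. Grouping the Rademacher sum by this pair [j] bounds the
   supremum by [\sum_j `|A_j|], where [A_j] is the sum of the signs in group
   [j]; moreover the second moments of the [A_j] add up to [n], so
   Cauchy-Schwarz concludes. *)
Require Import Defs.
From mathcomp Require Import all_boot all_order all_algebra finmap.
From mathcomp Require Import all_classical all_reals all_analysis.
From mathcomp Require Import ring lra.

Import Order.TTheory GRing.Theory Num.Theory.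

Local Open Scope classical_set_scope.
Local Open Scope ring_scope.

Lemma loss01E (R : realType) (K : nat) (P : probability 'I_K.+1 R)
    (y : 'I_K.+1) : loss01 P y = fine (P (~` [set y])).
Proof.
rewrite /loss01 -(@expectation_indic _ _ _ P (~` [set y])) //.
congr (fine (expectation _ _)); apply/funext => z.
rewrite indicE in_setC; congr (~~ _)%:R.
by apply/eqP/idP => [->|/set_mem//]; exact: mem_set.
Qed.

Lemma normr_loss01_le1 (R : realType) (K : nat) (P : probability 'I_K.+1 R)
    (y : 'I_K.+1) : `|loss01 P y| <= 1.
Proof.
have mA : measurable (~` [set y]) by [].
rewrite loss01E ger0_norm ?fine_ge0 //.
by rewrite -lee_fin fineK ?fin_num_measure // probability_le1.
Qed.

Lemma dist_loss01_le_dTV (R : realType) (K : nat)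
    (P Q : probability 'I_K.+1 R) (y : 'I_K.+1) :
  (`|loss01 P y - loss01 Q y|%:E <= dTV P Q)%E.
Proof.
have mA : measurable (~` [set y]) by [].
rewrite !loss01E; apply: ereal_sup_ubound; exists (~` [set y]) => //.
rewrite -[X in (X - _)%E]fineK ?fin_num_measure //.
by rewrite -[X in (_ - X)%E]fineK ?fin_num_measure.
Qed.

(** Orthogonality of the signs, up to the normalization [2 ^ n]. For distinct indices, flipping the
    [i]-th bit is an involution on sign vectors that negates the summand, so the sum equals its own
    opposite. *)
Lemma sum_sign_mul (R : realType) (n : nat) (i k : 'I_n) :
  \sum_(b : {ffun 'I_n -> bool}) ((-1) ^+ b i * (-1) ^+ b k : R) =
  (2 ^ n)%:R * (i == k)%:R.
Proof.
have [<-|ik] := eqVneq i k.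
  under eq_bigr do rewrite -expr2 sqrr_sign.
  by rewrite sumr_const card_ffun card_bool card_ord mulr1.
rewrite mulr0.
pose flip (b : {ffun 'I_n -> bool}) : {ffun 'I_n -> bool} :=
  [ffun l => if l == i then ~~ b l else b l].
have flipK : involutive flip.
  by move=> b; apply/ffunP => l; rewrite !ffunE; case: eqP => // _; rewrite negbK.
set s := LHS; suff : s = - s by lra.
rewrite {1}/s (reindex_inj (inv_inj flipK)) /= -sumrN.
apply: eq_bigr => b _; rewrite !ffunE eqxx eq_sym (negbTE ik).
by rewrite signrN mulNr.
Qed.

(** Expanding the squares, orthogonality leaves only the diagonal terms: each group contributes
    [2 ^ n] times its size, and the groups partition ['I_n]. *)
Lemma sum_sqr_group_signs (R : realType) (n : nat) (J : finType)
    (g : 'I_n -> J) :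
  \sum_(b : {ffun 'I_n -> bool})
     \sum_j (\sum_(i < n | g i == j) (-1) ^+ b i : R) ^+ 2 = (2 ^ n * n)%:R.
Proof.
have sqr_group j : \sum_(b : {ffun 'I_n -> bool})
    (\sum_(i < n | g i == j) (-1) ^+ b i : R) ^+ 2 =
    \sum_(i < n | g i == j) (2 ^ n)%:R.
  transitivity (\sum_(b : {ffun 'I_n -> bool}) \sum_(i < n | g i == j)
      \sum_(k < n | g k == j) ((-1) ^+ b i * (-1) ^+ b k : R)).
    by apply: eq_bigr => b _; rewrite expr2 big_distrlr.
  rewrite exchange_big; apply: eq_bigr => i gij /=.
  rewrite exchange_big /= (bigD1 i) //= sum_sign_mul eqxx mulr1.
  rewrite big1 ?addr0 // => k /andP[_ ki].
  by rewrite sum_sign_mul eq_sym (negbTE ki) mulr0.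
rewrite exchange_big /=; under eq_bigr do rewrite sqr_group.
rewrite -(@partition_big _ _ _ _ _ _ xpredT g xpredT (fun=> (2 ^ n)%:R)) //.
rewrite sumr_const card_ord.
by rewrite natrM mulr_natr.
Qed.

(* AM-GM in the form [2 |a| <= t a^2 + 1 / t]; with [t] the square root of
   [#|J| / n] the two terms balance on average. *)
Lemma mean_sum_norm_group_signs (R : realType) (n : nat) (J : finType)
    (g : 'I_n -> J) : (0 < n)%N ->
  \sum_(b : {ffun 'I_n -> bool}) 2^-1 ^+ n *
     (\sum_j `|\sum_(i < n | g i == j) (-1) ^+ b i| : R) <=
  n%:R * Num.sqrt (#|J|%:R / n%:R).
Proof.
move=> n0; set t := Num.sqrt _.
have nR0 : 0 < n%:R :> R by rewrite ltr0n.
have J0 : (0 < #|J|)%N by apply/card_gt0P; exists (g (Ordinal n0)).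
have t0 : 0 < t by rewrite sqrtr_gt0 divr_gt0 // ltr0n.
have t2 : t * t * n%:R = #|J|%:R.
  by rewrite -expr2 sqr_sqrtr ?divfK ?gt_eqF // divr_ge0.
have amgm (a : R) : `|a| <= 2^-1 * t * a ^+ 2 + 2^-1 * t^-1.
  rewrite -[a ^+ 2]real_normK ?num_real //; set u := `|a|.
  (* Dividing the square by [t] gives exactly the two terms of the bound minus [2 * u]. *)
  have : 0 <= t^-1 * (t * u - 1) ^+ 2 by rewrite mulr_ge0 ?invr_ge0 ?sqr_ge0 ?ltW.
  have -> : t^-1 * (t * u - 1) ^+ 2 = t * u ^+ 2 - 2 * u + t^-1.
    by field; rewrite gt_eqF.
  lra.
rewrite -mulr_sumr.
have : \sum_(b : {ffun 'I_n -> bool})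
     (\sum_j `|\sum_(i < n | g i == j) (-1) ^+ b i| : R) <=
   \sum_(b : {ffun 'I_n -> bool}) (2^-1 * t *
     (\sum_j (\sum_(i < n | g i == j) (-1) ^+ b i) ^+ 2) +
       #|J|%:R * (2^-1 * t^-1)).
  apply: ler_sum => b _; rewrite mulr_sumr mulr_natl -sumr_const -big_split /=.
  by apply: ler_sum => j _; exact: amgm.
rewrite big_split /= -mulr_sumr sum_sqr_group_signs sumr_const card_ffun.
rewrite card_bool card_ord => /(ler_wpM2l _) H.
apply: (le_trans (H (2^-1 ^+ n) _)); first by rewrite exprn_ge0 ?invr_ge0.
(* Writing [#|J|] as [t * t * n] turns each of the two averaged terms into [n * t / 2], so equality
   holds here. *)
rewrite -t2 -[X in _ + X]mulr_natr natrM natrX exprVn le_eqVlt.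
apply/orP; left; apply/eqP.
by field; rewrite gt_eqF ?expf_neq0 ?pnatr_eq0.
Qed.

(** Split [f i] into [h (g i)] and an error. In the first part [h] is constant on each fiber of [g]
    and factors out of the inner sum; each error term costs at most [eps]. *)
Lemma sum_sign_loss_le (R : realType) (n : nat) (J : finType) (g : 'I_n -> J)
    (eps : R) (r f : 'I_n -> R) (h : J -> R) :
  (forall i, `|r i| <= 1) -> (forall j, `|h j| <= 1) ->
  (forall i, `|f i - h (g i)| <= eps) ->
  \sum_i r i * f i <= \sum_j `|\sum_(i < n | g i == j) r i| + n%:R * eps.
Proof.
move=> r1 h1 fh.
have -> : \sum_i r i * f i =
    \sum_i r i * h (g i) + \sum_i r i * (f i - h (g i)).
  by rewrite -big_split /=; apply: eq_bigr => i _; ring.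
apply: lerD.
  rewrite (partition_big g xpredT) //=; apply: ler_sum => j _.
  under eq_bigr => i /eqP -> do [].
  rewrite -mulr_suml (le_trans (ler_norm _)) // normrM.
  by rewrite ler_piMr.
rewrite mulr_natl -[X in _ *+ X]card_ord -sumr_const; apply: ler_sum => i _.
by rewrite (le_trans (ler_norm _)) // normrM -[leRHS]mul1r ler_pM.
Qed.

Theorem theorem5 (R : realType) (d K : nat) (X : set 'rV[R]_d)
    (hX : X `<=` cube R d) (p : \bar R) (hp : (1 <= p)%E)
    (alpha eps : R) (halpha : 0 < alpha) (heps : 0 <= eps)
    (n : nat) (hn : (1 <= n)%N) (S : 'I_n -> X * 'I_K.+1)
    (N : nat)
    (hN : is_external_covering_number X p alpha
            (range (fun i => val (S i).1)) N) :
  (rademacher_complexity S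
     (loss_class [set m : classifier K X | robust_TV p alpha eps m])
   <= (Num.sqrt (N%:R * K.+1%:R / n%:R) + eps)%:E)%E.
Proof.
have [[C [CX covC] cardC] _] := hN.
have CinX (c : C) : val c \in X by rewrite inE; apply: CX; exact: valP.
(* Classifiers are defined on [X] only, so evaluating them at a center uses that the covering lies
   in [X]. *)
pose center (c : C) : X := SigSub (CinX c).
have /choice[c hc] : forall i : 'I_n, exists c : C,
    lpnorm p (val (S i).1 - val (center c)) <= alpha.
  move=> i; have [|c cC hc] := covC (val (S i).1); first by exists i.
  by exists [` cC]%fset.
pose g i : C * 'I_K.+1 := (c i, (S i).2).
have cardJ : #|{: C * 'I_K.+1}|%:R = N%:R * K.+1%:R :> R.
  by rewrite card_prod card_ord -cardfE cardC natrM.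
(* The right-hand side does not mention the classifier, so a bound for each robust [m] bounds the
   supremum. *)
have sup_le (b : {ffun 'I_n -> bool}) :
  (ereal_sup [set (\sum_(i < n) (-1) ^+ b i * f (S i))%R%:E | f in
     loss_class [set m : classifier K X | robust_TV p alpha eps m]] <=
   (\sum_j `|\sum_(i < n | g i == j) (-1) ^+ b i| + n%:R * eps)%:E)%E.
  apply: ge_ereal_sup => _ [_ [m mrob <-] <-]; rewrite lee_fin.
  pose h (j : C * 'I_K.+1) := loss01 (m (center j.1)) j.2.
  apply: (sum_sign_loss_le _ _ _ g _ _ _ h).
  - by move=> i; rewrite normr_sign.
  - by move=> j; exact: normr_loss01_le1.
  - move=> i; rewrite -lee_fin (le_trans (dist_loss01_le_dTV _ _ _ _ _)) //.
    exact: mrob.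
have nR0 : 0 < n%:R :> R by rewrite ltr0n.
rewrite /rademacher_complexity /rademacher_expectation.
rewrite prodr_const card_ord.
have -> : Num.sqrt (N%:R * K.+1%:R / n%:R) + eps =
    n%:R^-1 * (n%:R * Num.sqrt (N%:R * K.+1%:R / n%:R) + n%:R * eps).
  by field; rewrite gt_eqF.
rewrite EFinM lee_wpmul2l ?lee_fin ?invr_ge0 //.
apply: (@le_trans _ _ (\sum_(b : {ffun 'I_n -> bool}) (2^-1 ^+ n)%:E *
   (\sum_j `|\sum_(i < n | g i == j) (-1) ^+ b i| + n%:R * eps)%:E)%E).
  by apply: lee_sum => b _; rewrite lee_wpmul2l ?sup_le // lee_fin exprn_ge0.
under eq_bigr do rewrite -EFinM mulrDr.
rewrite sumEFin lee_fin big_split /= lerD //.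
  by rewrite -cardJ; exact: mean_sum_norm_group_signs.
(* The [2 ^ n] weights [2^-1 ^+ n] add up to 1, so the constant [n%:R * eps] is its own mean. *)
rewrite sumr_const card_ffun card_bool card_ord -[leLHS]mulr_natl mulrA natrX.
by rewrite -exprMn divff ?pnatr_eq0 // expr1n mul1r.
Qed.
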